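(* Let $F$ be a field, let $n,k$ be positive integers and let $m$ be a nonnegative integer. Let $A_1,\ldots,A_n$ be finite nonempty subsets of $F$ with $|A_j|\in\{k,k+1\}$ for every $1\leqslant j\leqslant n$, and for each ordered pair $(i,j)$ with $1\leqslant i\neq j\leqslant n$ let $S_{ij}$ be a finite subset of $F$ with $|S_{ij}|=m$. Put $$C=\{a_1+\cdots+a_n:\ a_1\in A_1,\ldots,a_n\in A_n,\ a_i-a_j\notin S_{ij}\ \text{for all } 1\leqslant i\neq j\leqslant n\}.$$ If $p(F)>\max\{mn,\ \sum_{j=1}^n(|A_j|-1)-mn(n-1)\}$, then $$|C|\geqslant \sum_{j=1}^n(|A_j|-1)-mn(n-1)+1.$$
   Context: For a field $F$, $p(F)$ denotes the additive order of the multiplicative identity of $F$: it is the characteristic of $F$ if that is a prime, and $p(F)=\infty$ (larger than every integer) if $F$ has characteristic zero. $|X|$ denotes the cardinality of a finite set $X$. The sets $S_{ij}$ and $S_{ji}$ are not assumed to be related. *)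

(* Defs.v *)
From HB Require Import structures.
From mathcomp Require Import all_boot all_order all_algebra.
From mathcomp Require Import finmap boolp constructive_ereal.

Set Implicit Arguments.
Unset Strict Implicit.
Unset Printing Implicit Defensive.

Import Order.TTheory GRing.Theory Num.Theory.

Local Open Scope fset_scope.
Local Open Scope ring_scope.

(* Additive order of 1, in the extended integers so that it can be compared
   with negative integers; whether 1 has finite order is not decidable over an
   abstract field, hence the use of [pselect]. *)
Definition additive_order (F : fieldType) : \bar int :=
  if pselect (exists d : nat, (0 < d)%N && (d%:R == 0 :> F)) is left h
  then ((ex_minn h)%:Z)%:E else +oo%E.

(* [a] ranges over the choice functions of [A]; the diagonal values [S i i]
   play no role. *)
Definition restricted_sumset (F : fieldType) (n : nat)
    (A : 'I_n -> {fset F}) (S : 'I_n -> 'I_n -> {fset F}) : {fset F} :=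
  [fset c in [seq \sum_(i < n) fsval (a i) | a : {dffun forall i : 'I_n, A i}
     in [pred a : {dffun forall i : 'I_n, A i} | [forall i, forall j,
           (i != j) ==> (fsval (a i) - fsval (a j) \notin S i j)]]]].

Lemma restricted_sumsetP (F : fieldType) (n : nat)
    (A : 'I_n -> {fset F}) (S : 'I_n -> 'I_n -> {fset F}) (c : F) :
  reflect (exists a : 'I_n -> F,
             [/\ forall i, a i \in A i,
                 forall i j, i != j -> a i - a j \notin S i j
               & c = \sum_(i < n) a i])
          (c \in restricted_sumset A S).
Proof.
apply: (iffP idP) => [|[a [aA aS ->]]]; rewrite !inE /=.
  case/imageP=> a Pa ->.
  exists (fun i => fsval (a i)); split => [i|i j ij|//]; first exact: fsvalP.
  by move: Pa; rewrite inE => /forallP/(_ i)/forallP/(_ j)/implyP; apply.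
apply/imageP; exists [ffun i : 'I_n => [` aA i]] => /=.
  rewrite inE; apply/forallP => i; apply/forallP => j; apply/implyP => ij.
  by rewrite !ffunE /= aS.
by apply: eq_bigr => i _; rewrite ffunE.
Qed.

(* Main.v *)
Require Import Defs.
From mathcomp Require Import all_boot all_order all_algebra.
From mathcomp Require Import finmap boolp constructive_ereal.
From mathcomp Require Import zify.

(** Write [R i = |A i| - 1] and [N = \sum_i R i - m * n * (n - 1)], and suppose
    that [C] has at most [N] elements.  The product of the [m * n * (n - 1)]
    factors [a_i - a_j - s], [s] in [S i j], and of [N] factors
    [a_1 + ... + a_n - c], with [c] running over [C], then vanishes on the whole
    grid [A_1 x ... x A_n].  It is a product of [D = \sum_i R i] affine forms.

    Summing a polynomial of degree at most [D] over a grid with [R i + 1] nodes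
    in direction [i], against the Lagrange weights of the nodes, extracts its
    coefficient at [\prod_i X_i ^ (R i)].  For a product of [D] affine forms this
    coefficient only sees the linear parts, so the weighted sum is unchanged when
    both the grid and the constant terms are replaced ([gridsum_top]).  The
    required coefficient is thus nonzero as soon as one choice of a grid and of
    constants makes the weighted sum nonzero, and no closed formula for it (of
    Dyson or Aomoto type) has to be established.

    The choice made here is the grid of the images in [F] of the integer points
    with [0 <= x_i <= R i], the constants [0, ..., m - 1] for the forms
    [x_i - x_j], shifted by 1 when [i] precedes [j], and [N] consecutive
    constants for the sum.  If no difference form vanishes at an integer point,
    its coordinates are at distance at least [m] from each other, and at distance
    at least [m + 1] where the larger coordinate has the earlier index.  A
    coordinate with [r] others below it is then at least [m * r]; and, when the
    indices with the larger [R i] come first, it is at most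
    [R i - m * (n - 1 - r)].  The sum of the coordinates therefore takes only
    [N + 1] consecutive values ([sep_sum_ge], [sep_sum_le]); the lowest one is
    reached at a single point ([sep_sum_eq]) and the sum forms kill the [N]
    others.  The product is nonzero at exactly one point of the grid
    ([model_neq0]), hence so is the weighted sum ([gridsum_model_neq0]).

    All integers that have to be invertible in [F] are at most [max (m * n) N].
    This also covers the differences of nodes, since the [R i] differ by at most
    1 and have sum [m * n * (n - 1) + N] ([R_le_q]). *)

Import Order.TTheory GRing.Theory Num.Theory.

Set Implicit Arguments.
Unset Strict Implicit.

(** * Separated families of natural numbers *)

(** Each unordered pair of distinct elements contributes exactly one arc. *)
Lemma double_sum_tournament (I : finType) (R : rel I) :
  (forall i, ~~ R i i) -> (forall i j, i != j -> R i j = ~~ R j i) ->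
  (\sum_i #|[pred j | R j i]|).*2 = #|I| * #|I|.-1.
Proof.
move=> Rirr Rtot.
have E : \sum_i #|[pred j | R j i]| = \sum_i #|[pred j | R i j]|.
  under eq_bigr => i _ do rewrite -sum1_card big_mkcond.
  under [in RHS]eq_bigr => i _ do rewrite -sum1_card big_mkcond.
  by rewrite exchange_big.
rewrite -addnn {2}E -big_split /= -sum_nat_const; apply: eq_bigr => i _.
rewrite -cardUI [X in _ + X]eq_card0 ?addn0 => [|j]; last first.
  rewrite !inE; case: (eqVneq i j) => [->|/Rtot->]; first by rewrite (negPf (Rirr _)).
  by rewrite andbN.
rewrite -(cardC1 i); apply: eq_card => j; rewrite !inE.
case: (eqVneq j i) => [->|/Rtot->]; first by rewrite (negPf (Rirr _)).
by case: (R i j).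
Qed.

Section Spread.

Context {I : finType}.
Variables (m : nat) (lt : rel I) (x R : I -> nat).
Hypothesis lt_irr : forall i, ~~ lt i i.
Hypothesis lt_trans : transitive lt.
Hypothesis lt_total : forall i j, i != j -> lt i j = ~~ lt j i.
(* For [m > 0] the two conditions on a pair [i], [j] exclude [2 * m] consecutive
   values of the difference; the shift by [lt i j] is what makes the excluded
   interval asymmetric and the configuration of least sum unique. *)
Hypothesis x_sep : forall i j s, i != j -> s < m -> x i != x j + s + lt i j.

Let below (i : I) : nat := #|[pred j | x j < x i]|.

Lemma sep_gap i j : x j < x i -> x j + m + lt i j <= x i.
Proof.
move=> xji; rewrite leqNgt; apply/negP => xij.
have ij : i != j by apply: contraTneq xji => ->; rewrite ltnn.
have lt_s : x i - x j - lt i j < m by case: (lt i j) xij => /=; lia.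
by have := x_sep ij lt_s; case: (lt i j) xij => /=; lia.
Qed.

Lemma sep_neq i j : 0 < m -> i != j -> x i != x j.
Proof.
move=> m0; wlog ltji : i j / ~~ lt i j => [H ij|ij].
  case: (boolP (lt i j)) => [ltij|]; last by move/H; apply.
  by rewrite eq_sym H // 1?eq_sym // -lt_total.
by have := x_sep ij m0; rewrite (negPf ltji) !addn0.
Qed.

(** Going up from [x j] to [x i] through the intermediate values, each step
    costs at least [m], and if [i] precedes [j] then some step goes to an earlier
    index, which costs one more. *)
Lemma sep_chain i j : 0 < m -> x j < x i ->
  x j + m * below i + lt i j <= x i + m * below j.
Proof.
move=> m0; have [d le_d] := ubnP (x i - x j).
elim: d i j le_d => // d IHd i j le_d xji.
have [l /andP[xjl xli]|none] := pickP [pred l | x j < x l < x i].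
  have Hil := IHd i l ltac:(lia) xli; have Hlj := IHd l j ltac:(lia) xjl.
  suff: lt i j <= lt i l + lt l j by lia.
  case: (boolP (lt i j)) => // ltij; case: (boolP (lt i l)) => //= ltil.
  rewrite (@lt_trans i) // lt_total //.
  by apply: contraTneq xli => ->; rewrite ltnn.
have : below i <= (below j).+1.
  rewrite -add1n -(card1 j) -[X in _ <= X]cardUI.
  apply: leq_trans (leq_addr _ _); apply: subset_leq_card.
  apply/subsetP => l; rewrite !inE => xli.
  have := none l; rewrite /= xli andbT => /negbT; rewrite -leqNgt.
  case: (eqVneq l j) => //= lj; rewrite leq_eqVlt.
  by rewrite (negPf (sep_neq m0 lj)).
by have := sep_gap xji; nia.
Qed.

Lemma sep_lower i : m * below i <= x i.
Proof.
case: (posnP m) => [->|m0]; first by rewrite mul0n.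
case: (@arg_minnP _ i xpredT x isT) => b _ minb.
have b0 : below b = 0.
  by apply: eq_card0 => j; rewrite !inE ltnNge; apply/negbF/minb.
case: (eqVneq b i) => [<-|bi]; first by rewrite b0 muln0.
have xbi : x b < x i by rewrite ltn_neqAle sep_neq //; exact: minb.
have := sep_chain m0 xbi; rewrite b0; lia.
Qed.

Hypothesis x_le : forall i, x i <= R i.
Hypothesis R_le : forall i j, i != j -> R i <= R j + lt i j.

(** The bound comes from the largest coordinate [x t].  A coordinate whose index
    comes after [t] loses an extra 1 on the way down from [x t], which pays for
    the possible difference between [R t] and [R i]. *)
Lemma sep_upper i : x i + m * #|I|.-1 <= R i + m * below i.
Proof.
case: (posnP m) => [->|m0]; first by rewrite !mul0n !addn0.
case: (@arg_maxnP _ i xpredT x isT) => t _ maxt.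
have neq_lt j : j != t -> x j < x t.
  by move=> jt; rewrite ltn_neqAle sep_neq //; exact: maxt.
have tn : below t = #|I|.-1.
  rewrite -(cardC1 t); apply: eq_card => j; rewrite !inE.
  by case: eqVneq => [->|/neq_lt->//]; rewrite ltnn.
case: (eqVneq i t) => [->|it]; first by rewrite tn leq_add2r.
have := sep_chain m0 (neq_lt _ it); rewrite tn.
have := x_le t; have := @R_le t i; rewrite eq_sym => /(_ it); lia.
Qed.

Let rank (i : I) : nat := #|[pred j | lt j i]|.

(** The order of the values and the order of the indices both are strict total
    orders, so their ranks have the same sum. *)
Lemma sum_below : 0 < m -> \sum_i below i = \sum_i rank i.
Proof.
move=> m0; apply: double_inj.
rewrite !(double_sum_tournament (R := fun j i => _)) // => [i|i j ij].
  by rewrite ltnn.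
by rewrite -leqNgt ltn_neqAle sep_neq.
Qed.

Lemma sep_sum_ge : m * \sum_i rank i <= \sum_i x i.
Proof.
case: (posnP m) => [->|m0]; first by rewrite mul0n.
rewrite -sum_below // big_distrr /=; apply: leq_sum => i _; exact: sep_lower.
Qed.

Lemma sep_sum_le : \sum_i x i + m * \sum_i rank i <= \sum_i R i.
Proof.
case: (posnP m) => [->|m0].
  by rewrite mul0n addn0; apply: leq_sum.
have : \sum_i (x i + m * #|I|.-1) <= \sum_i (R i + m * below i).
  by apply: leq_sum => i _; exact: sep_upper.
rewrite !big_split /= -!big_distrr /= sum_below // sum_nat_const.
rewrite -(double_sum_tournament lt_irr lt_total) -addnn mulnDr.
by rewrite addnA leq_add2r.
Qed.

(** Equality in [sep_lower] for every index leaves no room for the extra 1 of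
    [sep_chain]: the values are sorted like the indices. *)
Lemma sep_sum_eq : \sum_i x i = m * \sum_i rank i -> forall i, x i = m * rank i.
Proof.
move=> sum_x.
have xE i : x i = m * below i.
  move: (sum_x); case: (posnP m) => [m0 /eqP|m0].
    rewrite m0 !mul0n sum_nat_eq0 => /forallP/(_ i)/eqP //.
  rewrite -sum_below // big_distrr /= => /esym/eqP sumE; apply/esym/eqP.
  have := @leqif_sum I xpredT (fun i => m * below i == x i) (fun i => m * below i) x.
  case=> [j _|_]; first exact/leqif_eq/sep_lower.
  by rewrite sumE => /esym/forall_inP/(_ i isT).
case: (posnP m) => [m0|m0] i; first by rewrite xE m0.
rewrite xE; congr (_ * _); apply: eq_card => j; rewrite !inE.
have noinv a b : x a < x b -> ~~ lt b a.
  move=> xab; apply/negP => ltba; have := @sep_chain b a m0 xab.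
  by rewrite ltba !xE; lia.
case: (eqVneq j i) => [->|ji]; first by rewrite ltnn (negPf (lt_irr _)).
case: ltngtP (sep_neq m0 ji) => // [/noinv|/noinv/negPf->//].
by rewrite (lt_total ji) => ->.
Qed.

End Spread.

Local Open Scope fset_scope.
Local Open Scope ring_scope.

(** * Weighted sums over grids *)

Definition node_weight (F : fieldType) (J : finType) (P : pred J) (x : J -> F)
    (t : J) : F :=
  \prod_(u in [predD1 P & t]) (x t - x u)^-1.

Lemma node_weight_neq0 (F : fieldType) (J : finType) (P : pred J) (x : J -> F)
    (t : J) :
  {in P &, injective x} -> P t -> node_weight P x t != 0.
Proof.
move=> xI Pt; rewrite /node_weight prodf_seq_neq0; apply/allP => u _.
apply/implyP; rewrite !inE => /andP[ut Pu].
by rewrite invr_eq0 subr_eq0; apply: contra_neq ut => /esym; apply: xI.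
Qed.

(** Both sides are the coefficient at ['X^r] of ['X^e], which is equal to its
    Lagrange interpolation polynomial at the [r + 1] nodes. *)
Lemma sum_node_weight (F : fieldType) (J : finType) (P : pred J) (x : J -> F)
    (r e : nat) :
  {in P &, injective x} -> #|P| = r.+1 -> (e <= r)%N ->
  \sum_(t in P) x t ^+ e * node_weight P x t = (e == r)%:R.
Proof.
move=> xI cardP le_er.
pose L t : {poly F} := \prod_(u in [predD1 P & t]) ('X - (x u)%:P).
have LE t : L t = \prod_(u <- enum [predD1 P & t]) ('X - (x u)%:P).
  by rewrite /L big_enum.
have sizeL t : t \in P -> size (L t) = r.+1.
  move=> Pt; rewrite LE size_prod_XsubC -cardE; congr _.+1.
  by move: (cardD1 t P); rewrite cardP Pt => -[].
have topL t : t \in P -> (L t)`_r = 1.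
  move=> Pt; have /monicP : L t \is monic by rewrite LE monic_prod_XsubC.
  by rewrite /lead_coef sizeL.
pose p := \sum_(t in P) (x t ^+ e * node_weight P x t) *: L t - 'X^e.
have p0 : p = 0.
  apply: (@roots_geq_poly_eq0 _ p [seq x t | t <- enum P]).
  - apply/allP => y /mapP[t]; rewrite mem_enum => Pt ->.
    rewrite rootE hornerD hornerN hornerXn horner_sum (bigD1 t) //=.
    rewrite [X in _ + X - _]big1 => [|u /andP[Pu ut]].
      rewrite addr0 hornerZ horner_prod /node_weight -mulrA -big_split /=.
      rewrite big1 ?mulr1 ?subrr // => u; rewrite !inE => /andP[ut Pu].
      rewrite hornerXsubC mulVf // subr_eq0.
      by apply: contra_neq ut => xtu; apply/esym/xI.
    rewrite hornerZ horner_prod (bigD1 t) ?inE /= ?[t == u]eq_sym ?ut //.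
    by rewrite hornerXsubC subrr mul0r mulr0.
  - rewrite map_inj_in_uniq ?enum_uniq // => u v.
    by rewrite !mem_enum; apply: xI.
  - rewrite size_map -cardE cardP.
    apply: leq_trans (size_polyD _ _) _; rewrite size_polyN size_polyXn.
    rewrite geq_max ltnS le_er andbT.
    apply: leq_trans (size_sum _ _ _) _; apply/bigmax_leqP => t Pt.
    by apply: leq_trans (size_scale_leq _ _) _; rewrite sizeL.
have := congr1 (fun q : {poly F} => q`_r) p0.
rewrite coefB coef0 coefXn coef_sum => /eqP; rewrite subr_eq0 => /eqP.
rewrite [r == e]eq_sym => <-; apply: eq_bigr => t Pt.
by rewrite coefZ topL // mulr1.
Qed.

Section Grid.

Context {F : fieldType} {I J T : finType}.
Variables (P : I -> pred J) (r : I -> nat).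
Hypothesis cardP : forall i, #|P i| = (r i).+1.

Definition gridsum (x : I -> J -> F) (g : (I -> F) -> F) : F :=
  \sum_(f in family P)
    g (fun i => x i (f i)) * \prod_i node_weight (P i) (x i) (f i).

(** The monomial factor is there for induction on [s]: expanding the first
    affine form turns the product into combinations of products of this shape
    with one form less ([gridsum_cons]). *)
Definition monomial_forms (e : I -> nat) (u : T -> I -> F) (c : T -> F) (s : seq T)
    (v : I -> F) : F :=
  (\prod_i v i ^+ e i) * \prod_(t <- s) (\sum_i u t i * v i - c t).

Lemma gridsum_monomial (x : I -> J -> F) (e : I -> nat) u c :
  gridsum x (monomial_forms e u c [::]) =
  \prod_i \sum_(t in P i) x i t ^+ e i * node_weight (P i) (x i) t.
Proof.
rewrite bigA_distr_big_dep; apply: eq_bigr => f _.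
by rewrite /monomial_forms big_nil mulr1 big_split.
Qed.

Lemma gridsum_cons (x : I -> J -> F) (e : I -> nat) u c t s :
  gridsum x (monomial_forms e u c (t :: s)) =
  \sum_i u t i * gridsum x (monomial_forms (fun l => (e l + (l == i))%N) u c s)
  - c t * gridsum x (monomial_forms e u c s).
Proof.
under eq_bigr => i _ do rewrite mulr_sumr.
rewrite exchange_big /= mulr_sumr -sumrB; apply: eq_bigr => f _.
rewrite /monomial_forms big_cons.
set v := fun i => x i (f i); set w := \prod_i node_weight _ _ _.
set M := \prod_i v i ^+ e i; set Q := \prod_(j <- s) _.
rewrite [RHS](_ : _ = (\sum_i u t i * v i) * (M * (Q * w)) - c t * (M * (Q * w))).
  by rewrite -mulrBl mulrCA -!mulrA.
congr (_ - _); last by rewrite -mulrA.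
rewrite mulr_suml; apply: eq_bigr => i _.
rewrite -!mulrA; congr (_ * _).
rewrite (_ : \prod_l _ = v i * M) -?mulrA //.
under eq_bigr => l _ do rewrite exprD.
rewrite big_split /= mulrC; congr (_ * _).
rewrite (bigD1 i) //= eqxx expr1 big1 ?mulr1 // => l /negPf->.
by rewrite expr0.
Qed.

Lemma sum_bump (e : I -> nat) (i : I) :
  (\sum_l (e l + (l == i)) = (\sum_l e l).+1)%N.
Proof.
rewrite big_split -addn1 /=; congr (_ + _)%N.
by rewrite (bigD1 i) //= eqxx big1 // => l /negPf->.
Qed.

(** A monomial of too small degree has a degree smaller than [r i] in some
    direction [i], and the corresponding one-dimensional sum is zero. *)
Lemma gridsum_low (x : I -> J -> F) (e : I -> nat) u c s :
  (forall i, {in P i &, injective (x i)}) ->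
  (\sum_i e i + size s < \sum_i r i)%N -> gridsum x (monomial_forms e u c s) = 0.
Proof.
move=> xI; elim: s e => [|t s IHs] e /= lt_er.
  have [i lt_i] : exists i, (e i < r i)%N.
    apply/existsP; apply: contraLR lt_er => /existsPn ge_er.
    by rewrite addn0 -leqNgt leq_sum // => i _; rewrite leqNgt.
  rewrite gridsum_monomial.
  rewrite (bigD1 i) //= (sum_node_weight (xI i) (cardP i) (ltnW lt_i)).
  by rewrite ltn_eqF // mul0r.
rewrite gridsum_cons IHs ?mulr0 ?subr0; last by lia.
by rewrite big1 // => i _; rewrite IHs ?mulr0 // sum_bump; lia.
Qed.

(** The constants [c] and [d] only enter terms of lower degree, which
    [gridsum_low] kills, and the one-dimensional sums of the remaining monomials
    do not depend on the nodes. *)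
Lemma gridsum_top (x y : I -> J -> F) (e : I -> nat) u c d s :
  (forall i, {in P i &, injective (x i)}) ->
  (forall i, {in P i &, injective (y i)}) ->
  (\sum_i e i + size s = \sum_i r i)%N ->
  gridsum x (monomial_forms e u c s) = gridsum y (monomial_forms e u d s).
Proof.
move=> xI yI; elim: s e => [|t s IHs] e /= eq_er; last first.
  rewrite !gridsum_cons !(gridsum_low (e := e)) ?mulr0 //; try lia.
  by congr (_ - _); apply: eq_bigr => i _; rewrite IHs // sum_bump; lia.
rewrite !gridsum_monomial.
have [i lt_i | ge_er] := pickP [pred i | (e i < r i)%N].
  rewrite (bigD1 i) //= (sum_node_weight (xI i) (cardP i) (ltnW lt_i)).
  rewrite [RHS](bigD1 i) //= (sum_node_weight (yI i) (cardP i) (ltnW lt_i)).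
  by rewrite ltn_eqF // !mul0r.
have eqe i : e i = r i.
  apply/eqP; have := @leqif_sum I xpredT (fun i => r i == e i) r e.
  case=> [j _|_].
    by apply: leqif_eq; rewrite leqNgt (negbT (ge_er j)).
  by rewrite -eq_er addn0 eqxx => /esym/forall_inP/(_ i isT)/eqP->.
apply: eq_bigr => i _.
by rewrite (sum_node_weight (xI i) (cardP i)) ?(sum_node_weight (yI i) (cardP i)) ?eqe.
Qed.

End Grid.

(** * The model grid *)

Lemma card_ord_le (q r : nat) : (r <= q)%N -> #|[pred t : 'I_q.+1 | (t <= r)%N]| = r.+1.
Proof.
move=> rq; rewrite -sum1_card.
by rewrite (big_ord_narrow (rq : (r < q.+1)%N)) sum1_card card_ord.
Qed.

Section Core.

Context {F : fieldType} {n : nat}.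
Variables (m N q : nat) (R : 'I_n -> nat).

Hypothesis natr_neq0 : forall d, (0 < d)%N -> (d <= q)%N -> d%:R != 0 :> F.
Hypothesis Nq : (N <= q)%N.
Hypothesis mnq : (m * n <= q)%N.
Hypothesis R_near : forall i j, (R i <= (R j).+1)%N.
Hypothesis sumR : (\sum_i R i = m * (n * n.-1) + N)%N.

Lemma natr_inj (a b : nat) : (a <= q)%N -> (b <= q)%N -> a%:R = b%:R :> F -> a = b.
Proof.
wlog leab : a b / (a <= b)%N => [H aq bq|_ bq abE].
  by case: (leqP a b) => [|/ltnW] leab ab; [|apply/esym]; apply: H.
apply/eqP; rewrite eqn_leq leab /= leqNgt; apply/negP => ltab.
have /eqP[] := @natr_neq0 (b - a)%N ltac:(lia) ltac:(lia).
by rewrite natrB // abE subrr.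
Qed.

Lemma natr_dist (a b : nat) : (a < b)%N -> (b <= a + q)%N -> a%:R - b%:R != 0 :> F.
Proof.
move=> ab baq; rewrite -opprB oppr_eq0 -natrB 1?ltnW //.
by apply: natr_neq0; lia.
Qed.

(** As the [R j] differ by at most 1, their sum is at least
    [n * R i - (n - 1)], while it is at most [q * (n - 1) + q = q * n]. *)
Lemma R_le_q i : (R i <= q)%N.
Proof.
have : (\sum_(j < n) R i <= \sum_(j < n) (R j + (j != i)))%N.
  by apply: leq_sum => j _; case: eqVneq => [->|_] /=; have := R_near i j; lia.
rewrite big_split /= sum_nat_const card_ord sumR.
have -> : (\sum_(j < n) (j != i) = n.-1)%N.
  by rewrite -[n in RHS](card_ord n) -(cardC1 i) -sum1_card [RHS]big_mkcond.
have n0 : (0 < n)%N := leq_ltn_trans (leq0n i) (ltn_ord i).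
have := leq_mul mnq (leqnn n.-1); rewrite -mulnA => mnq' nRi.
rewrite -ltnS -(ltn_pmul2l n0); nia.
Qed.

(** [sep_upper] needs an order of the indices along which [R] does not
    increase. *)
Definition big_first (i j : 'I_n) : bool :=
  (R j < R i)%N || (R i == R j) && (i < j)%N.

Lemma big_first_irr i : ~~ big_first i i.
Proof. by rewrite /big_first !ltnn andbF. Qed.

Lemma big_first_trans : transitive big_first.
Proof. by move=> j i l; rewrite /big_first; lia. Qed.

Lemma big_first_total i j : i != j -> big_first i j = ~~ big_first j i.
Proof. by rewrite -val_eqE /big_first /=; lia. Qed.

Lemma big_first_le i j : (R i <= R j + big_first i j)%N.
Proof. by rewrite /big_first; have := R_near i j; lia. Qed.

Definition rank (i : 'I_n) : nat := #|[pred j | big_first j i]|.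

Lemma rank_lt i j : big_first i j -> (rank i < rank j)%N.
Proof.
move=> ij; apply/proper_card/properP; split; last first.
  by exists i; rewrite !inE // (negPf (big_first_irr i)).
by apply/subsetP => l; rewrite !inE => /big_first_trans; apply.
Qed.

Lemma rank_le i : (rank i <= n.-1)%N.
Proof.
rewrite -[n in X in (_ <= X)%N](card_ord n) -(cardC1 i); apply/subset_leq_card.
apply/subsetP => j; rewrite !inE; apply: contraTneq => ->.
exact: big_first_irr.
Qed.

(** If [R i < m * (n - 1)] then every [R j] is at most [m * (n - 1)], so that
    their sum is too small. *)
Lemma mrank_le i : (m * rank i <= R i)%N.
Proof.
apply: leq_trans (_ : m * n.-1 <= _)%N; first by rewrite leq_mul2l rank_le orbT.
rewrite leqNgt; apply/negP => ltRi.
have : (\sum_j R j < \sum_(j < n) m * n.-1)%N.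
  rewrite (bigD1 i) // [X in (_ < X)%N](bigD1 i) //= -addSn leq_add //.
  by apply: leq_sum => j _; have := R_near j i; lia.
by rewrite sumR sum_nat_const card_ord mulnCA ltnNge leq_addr.
Qed.

(* Pairs of distinct indices are written [(i, lift i j)], so that their number
   [n * n.-1] is read off the type. *)
Let T : finType := ('I_n * 'I_n.-1 * 'I_m + 'I_N)%type.

Definition form (t : T) (l : 'I_n) : F :=
  match t with
  | inl (i, j, _) => (l == i)%:R - (l == lift i j)%:R
  | inr _ => 1
  end.

Definition shifts (S : 'I_n -> 'I_n -> nat -> F) (C : nat -> F) (t : T) : F :=
  match t with
  | inl (i, j, s) => S i (lift i j) s
  | inr s => C s
  end.

Lemma form_diff i j (s : 'I_m) (v : 'I_n -> F) :
  \sum_l form (inl (i, j, s)) l * v l = v i - v (lift i j).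
Proof.
under eq_bigr => l _ do rewrite mulrBl.
rewrite sumrB; congr (_ - _).
  by rewrite (bigD1 i) //= eqxx mul1r big1 ?addr0 // => l /negPf->; rewrite mul0r.
rewrite (bigD1 (lift i j)) //= eqxx mul1r big1 ?addr0 // => l /negPf->.
by rewrite mul0r.
Qed.

Lemma form_sum (s : 'I_N) (v : 'I_n -> F) :
  \sum_l form (inr s) l * v l = \sum_l v l.
Proof. by apply: eq_bigr => l _; rewrite mul1r. Qed.

Definition forms_at (S : 'I_n -> 'I_n -> nat -> F) (C : nat -> F) (v : 'I_n -> F) : F :=
  monomial_forms (fun=> 0%N) form (shifts S C) (enum T) v.

Lemma forms_at_neq0P S C v :
  reflect [/\ forall i j s, i != j -> (s < m)%N -> v i - v j != S i j s
            & forall s, (s < N)%N -> \sum_l v l != C s]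
          (forms_at S C v != 0).
Proof.
rewrite /forms_at /monomial_forms [\prod_(i < n) _]big1 => [|i _]; last by rewrite expr0.
rewrite mul1r.
rewrite prodf_seq_neq0; apply: (iffP allP) => [nz | [nzS nzC] t _].
  split=> [i j s ij sm | s sN].
    have [j' ->] := unlift_some ij.
    have := nz (inl (i, j', Ordinal sm)) (mem_enum _ _).
    by rewrite form_diff /= subr_eq0.
  have := nz (inr (Ordinal sN)) (mem_enum _ _).
  by rewrite form_sum /= subr_eq0.
case: t => [[[i j] s] | s].
  by rewrite form_diff /= subr_eq0 nzS // neq_lift.
by rewrite form_sum /= subr_eq0 nzC.
Qed.

Let P (i : 'I_n) : pred 'I_q.+1 := [pred t : 'I_q.+1 | (t <= R i)%N].

Let cardP i : #|P i| = (R i).+1.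
Proof. exact/card_ord_le/R_le_q. Qed.

Let natr_injP i : {in P i &, injective (fun t : 'I_q.+1 => (t : nat)%:R : F)}.
Proof.
move=> a b _ _ /= ab; apply/val_inj/natr_inj => //; rewrite -ltnS; exact: ltn_ord.
Qed.

Definition model_shift (i j : 'I_n) (s : nat) : F := (s + big_first i j)%:R.
Definition model_sum (s : nat) : F := (m * \sum_i rank i + s.+1)%:R.

(** The only surviving point is the tightest separated configuration
    [m * rank i]. *)
Lemma model_neq0 (f : 'I_n -> nat) : (forall i, (f i <= R i)%N) ->
  (forms_at model_shift model_sum (fun i => (f i)%:R) != 0) =
  [forall i, f i == (m * rank i)%N].
Proof.
move=> fR; have fq i : (f i <= q)%N by rewrite (leq_trans (fR i)) ?R_le_q.
apply/forms_at_neq0P/forallP => [[nzS nzC] i | fE].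
  have x_sep a b s : a != b -> (s < m)%N -> f a != (f b + s + big_first a b)%N.
    move=> ab sm; apply: contra (nzS a b s ab sm) => /eqP->.
    by rewrite /model_shift -addnA natrD addrAC subrr add0r.
  set sig := (\sum_i rank i)%N in nzC *; pose tot := (\sum_i f i)%N.
  have sum_ge : (m * sig <= tot)%N.
    exact: sep_sum_ge big_first_irr big_first_trans big_first_total x_sep.
  have sum_le : (tot + m * sig <= \sum_i R i)%N.
    apply: sep_sum_le big_first_irr big_first_trans big_first_total x_sep fR _.
    by move=> a b _; exact: big_first_le.
  have sum_eq : tot = (m * sig)%N -> forall i, f i = (m * rank i)%N.
    exact: sep_sum_eq big_first_irr big_first_trans big_first_total x_sep.
  apply/eqP/sum_eq.
  apply/eqP; rewrite eqn_leq sum_ge andbT leqNgt; apply/negP => lt_sum.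
  have half : (sig + sig = n * n.-1)%N.
    have := double_sum_tournament big_first_irr big_first_total.
    by rewrite card_ord -addnn.
  (* The sum lies strictly above its least value by at most [N], so one of the
     sum forms vanishes. *)
  pose s := (tot - (m * sig).+1)%N.
  have sN : (s < N)%N by rewrite sumR -half mulnDr in sum_le; rewrite /s; lia.
  have := nzC s sN; rewrite -natr_sum /model_sum -addSnnS subnKC //.
  by rewrite eqxx.
have {fE}fE i : f i = (m * rank i)%N by apply/eqP.
split=> [i j s ij sm | s sN]; rewrite -subr_eq0.
  (* The integer [m * (rank i - rank j) - s - big_first i j] is nonzero and its
     absolute value is at most [m * n]. *)
  rewrite /model_shift !fE -addrA -opprD -natrD.
  have := rank_le i; have := rank_le j.
  case: (boolP (big_first i j)) => [/rank_lt ltij|].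
    move=> ri rj; apply: natr_dist; first by nia.
    by nia.
  rewrite (big_first_total ij) negbK => /rank_lt ltji ri rj.
  rewrite addn0 -natrB; last by nia.
  by apply: natr_neq0; nia.
have -> : \sum_l (f l)%:R = (m * \sum_l rank l)%:R :> F.
  by rewrite -natr_sum big_distrr /=; congr _%:R; apply: eq_bigr => l _.
apply: natr_dist; first by rewrite addnS ltnS leq_addr.
by rewrite leq_add2l (leq_trans _ Nq).
Qed.

Lemma gridsum_model_neq0 :
  gridsum P (fun _ t => (t : nat)%:R) (forms_at model_shift model_sum) != 0.
Proof.
have lt_q i : (m * rank i < q.+1)%N by rewrite ltnS (leq_trans (mrank_le i)) ?R_le_q.
pose f0 : {ffun 'I_n -> 'I_q.+1} := [ffun i => Ordinal (lt_q i)].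
have Pf0 : f0 \in family P.
  by apply/familyP => i; rewrite ffunE inE /= mrank_le.
rewrite /gridsum (bigD1 f0) //= [X in _ + X]big1 ?addr0 => [|f /andP[/familyP Pf ff0]].
  apply: mulf_neq0.
    rewrite model_neq0 => [|i]; last by rewrite ffunE /= mrank_le.
    by apply/forallP => i; rewrite ffunE.
  rewrite prodf_seq_neq0; apply/allP => i _; apply: node_weight_neq0 => //.
  by move/familyP: Pf0 => /(_ i).
apply/eqP; rewrite mulf_eq0; apply/orP; left; apply: contraR ff0.
rewrite model_neq0 => [/forallP fE|i]; last exact: Pf.
by apply/eqP/ffunP => i; rewrite ffunE; apply/val_inj/eqP/fE.
Qed.

(** Otherwise the product built from [S] and from the elements of the sumset
    vanishes on the whole grid of the [A i], although its weighted sum is that of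
    the model grid. *)
Lemma restricted_sumset_card_gt (A : 'I_n -> {fset F}) (S : 'I_n -> 'I_n -> {fset F}) :
  (forall i, #|` A i| = (R i).+1) ->
  (forall i j, i != j -> (#|` S i j| <= m)%N) ->
  (N < #|` restricted_sumset A S|)%N.
Proof.
move=> cardA cardS; set C := restricted_sumset A S; rewrite ltnNge; apply/negP => leCN.
pose x (i : 'I_n) (t : 'I_q.+1) : F := nth 0 (A i) t.
(* Beyond the size of [S i j] or [C] the default 0 pads the product with further
   forms, up to the exact degree [\sum_i R i]. *)
pose SA (i j : 'I_n) (s : nat) : F := nth 0 (S i j) s.
pose CA (s : nat) : F := nth 0 C s.
have xI i : {in P i &, injective (x i)}.
  move=> a b; rewrite !inE => aR bR /eqP.
  by rewrite nth_uniq ?cardA ?fset_uniq // => /eqP/val_inj.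
have sizeT : (\sum_(i < n) 0 + size (enum T) = \sum_i R i)%N.
  by rewrite big1 // -cardE card_sum !card_prod !card_ord sumR; lia.
have := gridsum_model_neq0.
rewrite -(gridsum_top cardP form (shifts SA CA) _ xI natr_injP sizeT).
case/eqP; rewrite /gridsum big1 // => f /familyP Pf.
apply/eqP; rewrite mulf_eq0; apply/orP; left.
rewrite -/(forms_at SA CA _); apply/negPn/negP => /forms_at_neq0P[nzS nzC].
have : \sum_l x l (f l) \in C.
  apply/restricted_sumsetP; exists (fun i => x i (f i)); split=> // [i|i j ij].
    by rewrite mem_nth // cardA ltnS; apply: Pf.
  apply/negP => inS; have lt_m : (index (x i (f i) - x j (f j))%R (S i j) < m)%N.
    by apply: leq_trans (cardS i j ij); rewrite index_mem.
  by have := nzS i j _ ij lt_m; rewrite /SA nth_index ?eqxx.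
move=> inC; have lt_N : (index (\sum_l x l (f l))%R C < N)%N.
  by apply: leq_trans leCN; rewrite index_mem.
by have := nzC _ lt_N; rewrite /CA nth_index ?eqxx.
Qed.

End Core.

(** * The restricted sumset *)

Lemma natr_neq0_lt_additive_order (F : fieldType) (q d : nat) :
  (q%:Z%:E < additive_order F)%E -> (0 < d)%N -> (d <= q)%N -> d%:R != 0 :> F.
Proof.
rewrite /additive_order; case: pselect => [h|no_order _ d0 _]; last first.
  by apply/negP => d_eq0; apply: no_order; exists d; rewrite d0.
rewrite lte_fin ltz_nat; case: ex_minnP => o _ o_min qo d0 dq.
apply/negP => d_eq0; have := o_min d; rewrite d0 d_eq0 => /(_ isT).
by rewrite leqNgt (leq_ltn_trans dq).
Qed.

Theorem theorem1p2 (F : fieldType) (n k m : nat)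
    (hn : (0 < n)%N) (hk : (0 < k)%N)
    (A : 'I_n -> {fset F}) (S : 'I_n -> 'I_n -> {fset F})
    (hA0 : forall j : 'I_n, A j != fset0)
    (hA : forall j : 'I_n, #|` A j| = k \/ #|` A j| = k.+1)
    (hS : forall i j : 'I_n, i != j -> #|` S i j| = m)
    (hp : ((Num.max (m%:Z * n%:Z)
                    (\sum_(j < n) (#|` A j|%:Z - 1) - m%:Z * n%:Z * (n%:Z - 1)))%:E
           < additive_order F)%E) :
  \sum_(j < n) (#|` A j|%:Z - 1) - m%:Z * n%:Z * (n%:Z - 1) + 1
    <= #|` restricted_sumset A S|%:Z.
Proof.
pose R j := (#|` A j|).-1.
have cardA j : #|` A j| = (R j).+1 by rewrite /R; case: (hA j) => ->; lia.
have sumE : \sum_(j < n) (#|` A j|%:Z - 1) = (\sum_j R j)%N%:Z.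
  rewrite (big_morph Posz PoszD erefl); apply: eq_bigr => j _; rewrite cardA; lia.
have prodE : m%:Z * n%:Z * (n%:Z - 1) = (m * (n * n.-1))%N%:Z.
  by rewrite -subn1 !PoszM -subzn // mulrA.
rewrite sumE prodE -PoszM in hp *.
have [ltR|leR] := ltnP (\sum_j R j)%N (m * (n * n.-1))%N; first by lia.
have subE : (\sum_j R j)%N%:Z - (m * (n * n.-1))%N%:Z
  = (\sum_j R j - m * (n * n.-1))%N%:Z by rewrite subzn.
set N := (\sum_j R j - m * (n * n.-1))%N in subE.
rewrite subE -PoszD addn1 lez_nat; rewrite subE in hp.
have maxE : Num.max (m * n)%N%:Z N%:Z = (maxn (m * n) N)%:Z by lia.
rewrite maxE in hp.
apply: (@restricted_sumset_card_gt F n m N (maxn (m * n) N) R) => //.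
- by move=> d d0; apply: natr_neq0_lt_additive_order hp d0.
- exact: leq_maxr.
- exact: leq_maxl.
- by move=> i j; rewrite /R; case: (hA i) => ->; case: (hA j) => ->; lia.
- by rewrite subnKC.
- by move=> i j ij; rewrite hS.
Qed.
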